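(* Let $(\pi_r)_{r\in\mathbb{N}}$ be periods and let $(K_t)_{t\in\mathbb{N}}$ be the multiperiodic process with periods $(\pi_r)$. For $T\in\mathbb{N}$ let $\mathcal{N}_T:=\{K_1,\dots,K_T\}$ be the random set of types. Then for every $T\in\mathbb{N}$ and every $q>0$, $$H(K_1^T)\le\left(e\,\mathbb{E}\operatorname{card}\mathcal{N}_T+2\right)\left((q+2)\log T+q\log\mathbb{E}K_t^{1/q}\right).$$
   Context: $\mathbb{N}=\{1,2,3,\dots\}$; $\log$ is the natural logarithm; $H(K_1^T)=\mathbb{E}[-\log P(K_1^T)]$ is the Shannon entropy of the block $K_1^T=(K_1,\dots,K_T)$. Multiperiodic sequence with periods $\pi_r\in\mathbb{N}$ and seeds $\sigma_r\in\{1,\dots,\pi_r\}$: the sequence $(k_t)_{t\in\mathbb{N}}$ with values in $\mathbb{N}\cup\{\infty\}$ such that for each $r$, the subsequence obtained from $(k_t)$ by deleting all tokens $k_t<r$, denoted $(k^{(r)}_t)_{t\in\mathbb{N}}$, satisfies $k^{(r)}_t=r\iff t\equiv\sigma_r\pmod{\pi_r}$; entries left undefined for all $r$ are set to $\infty$. Equivalently: clocks $\phi_r$ start at $\sigma_r$; for each token, scan $r=1,2,\dots$, decrementing each clock with $\phi_r>1$, until the first $r$ with $\phi_r=1$, output that $r$ and reset $\phi_r=\pi_r$. The multiperiodic process with periods $(\pi_r)$ is the random multiperiodic sequence with these periods and independent random seeds $\Sigma_r$ uniformly distributed on $\{1,\dots,\pi_r\}$; it is stationary, so $\mathbb{E}K_t^{1/q}$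 does not depend on $t$. *)

(* Defs.v *)
From HB Require Import structures.
From mathcomp Require Import all_boot all_order all_algebra.
From mathcomp Require Import all_classical all_reals all_analysis.
Set Implicit Arguments. Unset Strict Implicit. Unset Printing Implicit Defensive.
Import Order.TTheory GRing.Theory Num.Theory.
Local Open Scope classical_set_scope.
Local Open Scope ring_scope.

(* ---------- Deterministic multiperiodic sequence (clock description) ------
   Ranks r are the positive naturals; index 0 of [pi] / [sigma] is unused.
   [step pi phi] is the update of the clocks when one token is produced:
   ranks scanned before the first rank whose clock equals 1 are decremented,
   that rank is reset to its period, later ranks are untouched.  If no rank
   fires, every clock is decremented (and the token is infinity).          *)
Definition step (pi phi : nat -> nat) : nat -> nat :=
  fun r => if all (fun r' => phi r' != 1%N) (iota 1 r.-1)
           then (if phi r == 1%N then pi r else (phi r - 1)%N)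
           else phi r.

(* clocks before producing token number n+1 *)
Definition clocks (pi sigma : nat -> nat) (n : nat) : nat -> nat :=
  iter n (step pi) sigma.

(* token k_t (t >= 1): the first rank r >= 1 whose clock equals 1,
   or None (= infinity) if there is none. *)
Definition mp_token (pi sigma : nat -> nat) (t : nat) : option nat :=
  let phi := clocks pi sigma t.-1 in
  match pselect (exists r, (0 < r)%N && (phi r == 1%N)) with
  | left H => Some (@ex_minn (fun r => (0 < r)%N && (phi r == 1%N)) H)
  | right _ => None
  end.

Definition uniform_seeds {d} {Omega : measurableType d} {R : realType}
    (P : probability Omega R) (pi : nat -> nat) (Sigma : nat -> Omega -> nat) :=
  forall r, (0 < r)%N -> forall i, (1 <= i <= pi r)%N ->
    P [set w | Sigma r w = i] = ((pi r)%:R^-1)%:E.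

Definition independent_seeds {d} {Omega : measurableType d} {R : realType}
    (P : probability Omega R) (Sigma : nat -> Omega -> nat) :=
  forall (F : seq nat) (v : nat -> nat), uniq F -> all (fun r => 0 < r)%N F ->
    P [set w | forall r, r \in F -> Sigma r w = v r] =
    (\prod_(r <- F) P [set w | Sigma r w = v r])%E.

Definition measurable_seeds {d} {Omega : measurableType d}
    (Sigma : nat -> Omega -> nat) :=
  forall r i, measurable [set w | Sigma r w = i].

Definition mpK (pi : nat -> nat) {Omega : Type} (Sigma : nat -> Omega -> nat)
    (t : nat) (w : Omega) : option nat :=
  mp_token pi (fun r => Sigma r w) t.

Definition block_prob {d} {Omega : measurableType d} {R : realType}
    (P : probability Omega R) (K : nat -> Omega -> option nat) (T : nat)
    (k : {ffun 'I_T -> option nat}) : R :=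
  fine (P [set w | forall i : 'I_T, K i.+1 w = k i]).

Definition block_entropy {d} {Omega : measurableType d} {R : realType}
    (P : probability Omega R) (K : nat -> Omega -> option nat) (T : nat)
    : \bar R :=
  (\esum_(k in [set: {ffun 'I_T -> option nat}])
     (- (block_prob P K k * ln (block_prob P K k)))%:E)%E.

Definition card_types {Omega : Type} (K : nat -> Omega -> option nat)
    (T : nat) (w : Omega) : nat :=
  size (undup [seq K t w | t <- iota 1 T]).

Definition root_token {R : realType} (q : R) (k : option nat) : \bar R :=
  match k with Some r => ((r%:R : R) `^ q^-1)%:E | None => +oo%E end.

Definition elog {R : realType} (x : \bar R) : \bar R :=
  match x with
  | x%:E => (ln x)%:E
  | +oo%E => +oo%E
  | -oo%E => -oo%E
  end.

(* Main.v *)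
Require Import Defs.
From HB Require Import structures.
From mathcomp Require Import all_boot all_order all_algebra.
From mathcomp Require Import all_classical all_reals all_analysis.
From mathcomp Require Import zify ring lra measurable_realfun.
Import Order.TTheory GRing.Theory Num.Theory.
Local Open Scope classical_set_scope.
Local Open Scope ring_scope.

(* A block is determined by the first occurrence times of its types: after the
   first occurrence of [r] its clock has been reset to [pi r], so the smaller
   types and the period dictate the later occurrences.  Hence the weights
   [\prod_(r in N) 1 / (T r^2)], N being the set of types of the block, sum to at
   most [\prod_r (1 + 1 / r^2) <= 4], and Gibbs' inequality gives
   [H <= ln 4 + E (\sum_(r in N) (ln T + 2 ln r))].  The tangent line of [ln] at
   [T A], where [A = E K_t^(1/q)], bounds [ln r] by
   [q (ln (T A) + r^(1/q) / (T A) - 1)], and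
   [E (\sum_(r in N) r^(1/q)) <= T A] by stationarity, so that
   [H <= ln 4 + mu ln T + 2 q mu ln (T A)] with [mu = E card N >= 1].
   For T = 1 the term [ln 4] cannot be absorbed by [ln T]; the weights then sum to
   at most [\sum_r 1 / r^2 <= 2], and [ln 2 <= 2 q ln A] unless [pi 1 = 1],
   because [K_1 >= 2] with probability at least 1/2. *)

(** * Clocks and first occurrences *)

Section Clocks.
Set Implicit Arguments. Unset Strict Implicit. Unset Printing Implicit Defensive.
Local Open Scope nat_scope.
Variable pi : nat -> nat.
Implicit Types (phi psi sigma : nat -> nat) (r n t : nat).

Lemma all_iota1P (a : pred nat) r :
  reflect (forall s, 0 < s < r -> a s) (all a (iota 1 r.-1)).
Proof.
apply: (iffP allP) => h s hs; apply: h.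
  by rewrite mem_iota; lia.
by move: hs; rewrite mem_iota; lia.
Qed.

Lemma eq_step phi psi r : 0 < r ->
  (forall s, 0 < s <= r -> phi s = psi s) -> step pi phi r = step pi psi r.
Proof.
move=> r0 h; rewrite /step (h r) ?r0 ?leqnn //.
congr (if _ then _ else _); apply: eq_in_all => s; rewrite mem_iota => hs.
by rewrite h//; lia.
Qed.

(** Inverse of [step] on clocks within their periods. A decremented clock lies strictly below its
    period, so the first rank whose clock equals its period is the one that just fired. *)
Definition unstep psi : nat -> nat :=
  fun r => if all (fun s => psi s != pi s) (iota 1 r.-1)
           then (if psi r == pi r then 1 else (psi r).+1)
           else psi r.

Definition in_box phi := forall r, 0 < r -> 0 < phi r <= pi r.

Lemma in_box_step phi : in_box phi -> in_box (step pi phi).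
Proof.
move=> b r r0; move: (b r r0); rewrite /step.
by case: ifP => // _; case: eqP => [_|]; lia.
Qed.

Lemma stepK phi r : in_box phi -> 0 < r -> unstep (step pi phi) r = phi r.
Proof.
move=> b r0; rewrite /unstep.
(* Both tests detect the same firing rank: along the scan, as long as nothing has fired, a new clock
   equals its period exactly when the old one was 1. *)
have -> : all (fun s => step pi phi s != pi s) (iota 1 r.-1) =
          all (fun s => phi s != 1) (iota 1 r.-1).
  apply/all_iota1P/all_iota1P => h.
    elim/ltn_ind => s ih hs; apply/eqP => e1.
    have := h _ hs; rewrite /step e1 eqxx ifT ?eqxx//.
    by apply/all_iota1P => u hu; apply: ih; lia.
  move=> s hs; have := b s; rewrite /step ifT; last first.
    by apply/all_iota1P => u hu; apply: h; lia.
  by rewrite (negbTE (h _ hs)); have := h _ hs; lia.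
rewrite /step; case: ifP => h; rewrite ?h //.
have := b r r0; case: (phi r =P 1%N) => [->|h1]; first by rewrite /= ?eqxx.
by case: eqP; lia.
Qed.

Lemma unstepK psi r : in_box psi -> 0 < r -> step pi (unstep psi) r = psi r.
Proof.
move=> b r0; rewrite /step.
have -> : all (fun s => unstep psi s != 1) (iota 1 r.-1) =
          all (fun s => psi s != pi s) (iota 1 r.-1).
  apply/all_iota1P/all_iota1P => h.
    elim/ltn_ind => s ih hs; apply/eqP => e1.
    have := h _ hs; rewrite /unstep e1 eqxx ifT ?eqxx//.
    by apply/all_iota1P => u hu; apply: ih; lia.
  move=> s hs; have := b s; rewrite /unstep ifT; last first.
    by apply/all_iota1P => u hu; apply: h; lia.
  by rewrite (negbTE (h _ hs)); have := h _ hs; lia.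
rewrite /unstep; case: ifP => h; rewrite ?h //.
have := b r r0; case: (psi r =P pi r) => [->|h1]; first by rewrite /= ?eqxx.
by case: eqP; lia.
Qed.

Lemma mp_token_SomeP sigma t r :
  reflect [/\ 0 < r, clocks pi sigma t.-1 r = 1
            & forall s, 0 < s < r -> clocks pi sigma t.-1 s != 1]
          (mp_token pi sigma t == Some r).
Proof.
rewrite /mp_token; case: pselect => [ex|nex]; last first.
  by apply: (iffP eqP) => // -[r0 e _]; case: nex; exists r; rewrite r0 e.
case: ex_minnP => m /andP[m0 /eqP em] hm; apply: (iffP eqP) => [[<-]|].
  split=> // s /andP[s0 sm]; apply/eqP => e1.
  by have := hm s; rewrite s0 e1 eqxx leqNgt sm => /(_ isT).
move=> [r0 e1 h]; congr Some; apply/eqP; rewrite eqn_leq hm ?r0 ?e1 //=.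
by rewrite leqNgt; apply/negP => mr; have := h m; rewrite m0 mr em => /(_ isT).
Qed.

Lemma mp_token_gt0 sigma t : mp_token pi sigma t != Some 0.
Proof. by apply/negP => /mp_token_SomeP[]. Qed.

Lemma mp_token_None_neq1 sigma t r : 0 < r -> mp_token pi sigma t = None ->
  clocks pi sigma t.-1 r != 1.
Proof.
move=> r0; rewrite /mp_token; case: pselect => // nex _.
by apply/eqP => e; case: nex; exists r; rewrite r0 e.
Qed.

(** Expresses the update through the emitted token alone, so that runs with equal tokens change
    their clocks alike. *)
Lemma clocks_tokenE sigma n r : 0 < r ->
  clocks pi sigma n.+1 r =
  if mp_token pi sigma n.+1 is Some s then
    if s == r then pi r else if r < s then (clocks pi sigma n r).-1
    else clocks pi sigma n r
  else (clocks pi sigma n r).-1.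
Proof.
move=> r0; rewrite /clocks iterS -/(clocks pi sigma n) /step subn1.
case E: (mp_token pi sigma n.+1) => [s|].
  have /eqP/mp_token_SomeP [s0 /= e1 h] := E.
  have [<-|srN] := eqVneq s r.
    by rewrite e1 eqxx ifT//; apply/all_iota1P.
  case: ltnP => rs.
    rewrite ifT; last by apply/all_iota1P => u hu; apply: h; lia.
    by rewrite ifN// h//; lia.
  rewrite ifN//; apply/negP => /all_iota1P /(_ s).
  by rewrite e1 eqxx => /(_ _)/notF; apply; lia.
rewrite ifT; last first.
  by apply/all_iota1P => u /andP[u0 _]; apply: (mp_token_None_neq1 u0 E).
by rewrite ifN//; apply: (mp_token_None_neq1 r0 E).
Qed.

(** Seeds are forgotten: emitting [r] sets its clock to [pi r], and from then on the tokens alone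
    drive it. *)
Lemma clocks_same_after sigma sigma' n r :
  (forall t, t < n -> mp_token pi sigma t.+1 = mp_token pi sigma' t.+1) ->
  (exists2 t, t < n & mp_token pi sigma t.+1 = Some r) ->
  clocks pi sigma n r = clocks pi sigma' n r.
Proof.
elim: n => [|n ih] h [t tn ht] //.
have r0 : 0 < r by case/eqP/mp_token_SomeP: ht.
rewrite !clocks_tokenE// -h//.
case: (eqVneq t n) => [<-|tn']; first by rewrite ht eqxx.
rewrite ih //; first by move=> u hu; apply: h; lia.
by exists t => //; lia.
Qed.

Definition tokens sigma (T : nat) : seq (option nat) :=
  [seq mp_token pi sigma t.+1 | t <- iota 0 T].

Lemma nth_tokens sigma T t : t < T ->
  nth None (tokens sigma T) t = mp_token pi sigma t.+1.
Proof. by move=> tT; rewrite (nth_map 0) ?size_iota// nth_iota. Qed.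

Lemma size_tokens sigma T : size (tokens sigma T) = T.
Proof. by rewrite size_map size_iota. Qed.

(** At a first disagreement let [a] be the smaller token. If [a] is new there, equal first
    occurrence times make the other run emit it too. If [a] is old, its clock is 1 in the other run
    as well, which then cannot emit anything larger, infinity included. *)
Let tokens_lt_absurd sigma sigma' T n a :
  (forall r, index (Some r) (tokens sigma T) = index (Some r) (tokens sigma' T)) ->
  (forall t, t < n -> mp_token pi sigma t.+1 = mp_token pi sigma' t.+1) ->
  n < T -> mp_token pi sigma n.+1 = Some a ->
  (forall b, mp_token pi sigma' n.+1 = Some b -> a < b) -> False.
Proof.
move=> hidx h nT ha hb.
have ain : Some a \in tokens sigma T.
  by rewrite -ha -(nth_tokens sigma nT)// mem_nth// size_tokens.
have iT : index (Some a) (tokens sigma T) < T.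
  by rewrite -[X in _ < X](size_tokens sigma T) index_mem.
have hi := nth_index None ain.
have ile : index (Some a) (tokens sigma T) <= n.
  rewrite leqNgt; apply/negP => lt.
  by have := @before_find _ None (pred1 (Some a)) (tokens sigma T) n lt;
     rewrite nth_tokens//= ha eqxx.
move: ile; rewrite leq_eqVlt => /orP[/eqP e|lt].
  have ain' : Some a \in tokens sigma' T.
    by rewrite -index_mem -hidx size_tokens.
  have := nth_index None ain'; rewrite -hidx e nth_tokens// => /hb.
  by rewrite ltnn.
have /eqP/mp_token_SomeP[a0 /= e1 _] := ha.
have e1' : clocks pi sigma' n a = 1.
  rewrite -(clocks_same_after h)//.
  exists (index (Some a) (tokens sigma T)) => //.
  by rewrite -(nth_tokens sigma iT).
case E: (mp_token pi sigma' n.+1) => [b|].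
  have ab := hb _ E.
  by case/eqP/mp_token_SomeP: E => b0 _ /(_ a); rewrite a0 ab /= e1' => /(_ isT).
by have /= := mp_token_None_neq1 a0 E; rewrite e1'.
Qed.

(** Strong induction on the position; the run with the smaller token at a first disagreement,
    infinity counting as largest, yields the contradiction. *)
Lemma tokens_inj sigma sigma' T :
  (forall r, index (Some r) (tokens sigma T) = index (Some r) (tokens sigma' T)) ->
  tokens sigma T = tokens sigma' T.
Proof.
move=> hidx; have hidx' r := esym (hidx r).
suff h n : n < T -> mp_token pi sigma n.+1 = mp_token pi sigma' n.+1.
  by apply/eq_in_map => n; rewrite mem_iota => /andP[_ /h].
elim/ltn_ind: n => n ih nT.
have h t : t < n -> mp_token pi sigma t.+1 = mp_token pi sigma' t.+1.
  by move=> tn; apply: ih => //; apply: ltn_trans nT.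
have h' t tn := esym (h t tn).
case E: (mp_token pi sigma n.+1) => [a|]; case E': (mp_token pi sigma' n.+1) => [b|] //.
- congr Some; case: (ltngtP a b) => // ab; exfalso.
  + by apply: (tokens_lt_absurd hidx h nT E) => c; rewrite E' => -[<-].
  + by apply: (tokens_lt_absurd hidx' h' nT E') => c; rewrite E => -[<-].
- by exfalso; apply: (tokens_lt_absurd hidx h nT E) => c; rewrite E'.
- by exfalso; apply: (tokens_lt_absurd hidx' h' nT E') => c; rewrite E.
Qed.

End Clocks.

(** * Weights of blocks *)

Section CodeWeights.
Set Implicit Arguments. Unset Strict Implicit. Unset Printing Implicit Defensive.
Variable R : realType.
Implicit Types (r n T : nat).

Lemma prod_1Dinv_sqr_le4 n : \prod_(r < n) (1 + (r.+1%:R ^+ 2)^-1) <= 4 :> R.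
Proof.
case: n => [|n]; first by rewrite big_ord0; lra.
(* The correction [1 - 1/(n+2)] makes the induction close; for a single factor it gives equality. *)
suff : \prod_(r < n.+1) (1 + (r.+1%:R ^+ 2)^-1) <= 4 * (1 - n.+2%:R^-1) :> R.
  by move=> /le_trans; apply; rewrite ler_piMr// gerBl invr_ge0.
elim: n => [|n ih].
  by rewrite big_ord_recr big_ord0 /= expr1n invr1; lra.
rewrite big_ord_recr /=.
apply: (le_trans (ler_wpM2r _ ih)).
  by rewrite addr_ge0// invr_ge0 exprn_ge0.
rewrite -(natr1 n.+2).
set x := n.+2%:R; have x0 : 0 < x :> R by rewrite ltr0n.
rewrite -subr_ge0.
suff -> : 4 * (1 - (x + 1)^-1) - 4 * (1 - x^-1) * (1 + (x ^+ 2)^-1)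
  = 4 * (x ^+ 3 * (x + 1))^-1 :> R.
  by rewrite mulr_ge0// invr_ge0 mulr_ge0 ?exprn_ge0 ?addr_ge0// ltW.
by field; rewrite !gt_eqF//; lra.
Qed.

Lemma sum_inv_sqr_le2 n : \sum_(r < n) (r.+1%:R ^+ 2)^-1 <= 2 :> R.
Proof.
case: n => [|n]; first by rewrite big_ord0; lra.
(* The correction telescopes, as [1/(x+1)^2 <= 1/x - 1/(x+1)]. *)
suff : \sum_(r < n.+1) (r.+1%:R ^+ 2)^-1 <= 2 - n.+1%:R^-1 :> R.
  by move=> /le_trans; apply; rewrite gerBl invr_ge0.
elim: n => [|n ih].
  by rewrite big_ord_recr big_ord0 /= expr1n invr1; lra.
rewrite big_ord_recr /=; apply: (le_trans (lerD ih (lexx _))).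
rewrite -(natr1 n.+1).
set x := n.+1%:R; have x0 : 0 < x :> R by rewrite ltr0n.
rewrite -subr_ge0.
suff -> : 2 - (x + 1)^-1 - (2 - x^-1 + ((x + 1) ^+ 2)^-1)
  = (x * (x + 1) ^+ 2)^-1 :> R.
  by rewrite invr_ge0 mulr_ge0 ?exprn_ge0 ?addr_ge0// ltW.
by field; rewrite !gt_eqF//; lra.
Qed.

Definition block (pi sigma : nat -> nat) T : {ffun 'I_T -> option nat} :=
  [ffun i : 'I_T => mp_token pi sigma i.+1].

Lemma codom_block pi sigma T : codom (block pi sigma T) = tokens pi sigma T.
Proof.
rewrite codomE /tokens -val_enum_ord -map_comp.
by apply: eq_map => i; rewrite /= ffunE.
Qed.

(** The factor [1/T] pays for the position of the first occurrence, and [1/r^2] is summable over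
    types. Infinity, excluded from feasible blocks, gets 0. *)
Definition weight T (o : option nat) : R :=
  if o is Some r then (T%:R * r%:R ^+ 2)^-1 else 0.

Definition block_weight T (k : {ffun 'I_T -> option nat}) : R :=
  \prod_(o <- undup (codom k)) weight T o.

Lemma weight_ge0 T o : 0 <= weight T o.
Proof. by case: o => //= r; rewrite invr_ge0 mulr_ge0// exprn_ge0. Qed.

Lemma token_bound T (F : seq {ffun 'I_T -> option nat}) :
  exists n, forall k r, k \in F -> Some r \in codom k -> (r <= n)%N.
Proof.
exists (\max_(k <- F) \max_(o <- codom k) odflt 0 o)%N => k r kF rk.
apply: (@leq_trans (\max_(o <- codom k) odflt 0 o)%N).
  exact: (@leq_bigmax_seq _ (codom k) xpredT (odflt 0%N) (Some r)).
exact: (@leq_bigmax_seq _ F xpredT (fun k0 => \max_(o <- codom k0) odflt 0 o)%N k).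
Qed.

Lemma ler_sum_uniq (I : finType) (s : seq I) (f : I -> R) : uniq s ->
  (forall i, 0 <= f i) -> \sum_(i <- s) f i <= \sum_i f i.
Proof.
move=> us f0; rewrite big_uniq//= big_mkcond/=.
by apply: ler_sum => i _; case: ifP.
Qed.

Definition feasible pi T (k : {ffun 'I_T -> option nat}) : Prop :=
  (exists sigma, k = block pi sigma T) /\ None \notin codom k.

Lemma feasible_gt0 pi T (k : {ffun 'I_T -> option nat}) r :
  feasible pi k -> Some r \in codom k -> (0 < r)%N.
Proof.
move=> [[sigma ->] _]; rewrite codom_block => /mapP[t _ e].
by case/esym/eqP/mp_token_SomeP: e.
Qed.

Let prod_undupE pi T (k : {ffun 'I_T -> option nat}) n :
  feasible pi k -> (forall r, Some r \in codom k -> (r <= n)%N) ->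
  block_weight k = \prod_(r < n)
    (if Some r.+1 \in codom k then weight T (Some r.+1) else 1).
Proof.
move=> fk hn; rewrite /block_weight.
have -> : \prod_(o <- undup (codom k)) weight T o =
  \prod_(o <- [seq o <- [seq Some r.+1 | r <- iota 0 n] | o \in codom k])
     weight T o.
  apply: perm_big; apply: uniq_perm; rewrite ?undup_uniq//.
    by rewrite filter_uniq// map_inj_uniq ?iota_uniq// => a b [].
  move=> o; rewrite mem_undup mem_filter; case kin : (o \in codom k) => //=.
  apply/esym/mapP; case: o kin => [r|] kin.
    have r0 := feasible_gt0 fk kin; have rn := hn _ kin.
    by exists r.-1; [rewrite mem_iota; lia | rewrite prednK].
  by case: fk => _; rewrite kin.
rewrite big_filter big_map big_mkcond/=.
by rewrite -(big_mkord xpredT (fun r =>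
  if Some r.+1 \in codom k then weight T (Some r.+1) else 1)) /index_iota subn0.
Qed.

(** The first occurrence positions, with [T] for an absent rank, encode feasible blocks injectively.
    Enlarging the sum to all functions from ranks to positions turns it into a product over
    ranks. *)
Lemma sum_block_weight_le pi T (F : seq {ffun 'I_T -> option nat}) n :
  (0 < T)%N -> uniq F -> (forall k, k \in F -> feasible pi k) ->
  (forall k r, k \in F -> Some r \in codom k -> (r <= n)%N) ->
  \sum_(k <- F) block_weight k <= \prod_(r < n) (1 + (r.+1%:R ^+ 2)^-1).
Proof.
move=> T0 uF hF hn.
pose y (r : 'I_n) (i : 'I_T.+1) : R :=
  if (i < T)%N then weight T (Some r.+1) else 1.
pose code (k : {ffun 'I_T -> option nat}) : {ffun 'I_n -> 'I_T.+1} :=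
  [ffun r : 'I_n => inord (index (Some r.+1) (codom k))].
have codeE k (r : 'I_n) : code k r = index (Some r.+1) (codom k) :> nat.
  rewrite ffunE inordK// ltnS (leq_trans (index_size _ _))//.
  by rewrite size_codom card_ord.
have code_inj : {in F &, injective code}.
  move=> k k' kF k'F e.
  have [[sigma ks] _] := hF _ kF; have [[sigma' k's] _] := hF _ k'F.
  have idx r : index (Some r) (codom k) = index (Some r) (codom k').
    have [/andP[r0 rn]|rN] := boolP (0 < r <= n)%N.
      have rn' : (r.-1 < n)%N by lia.
      by have := codeE k (Ordinal rn'); rewrite e codeE/= prednK.
    (* Rank 0 and ranks above [n] occur in no block of [F], so their index is the block length. *)
    have notin k0 : k0 \in F -> Some r \notin codom k0.
      move=> k0F; apply: contra rN => rk.
      by rewrite (feasible_gt0 (hF _ k0F) rk) (hn _ _ k0F rk).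
    by rewrite !memNindex ?notin// !size_codom.
  have : codom k = codom k'.
    move: idx; rewrite ks k's !codom_block => idx; exact: tokens_inj idx.
  rewrite !codomE => /eq_in_map ec; apply/ffunP => i; apply: ec.
  by rewrite mem_enum.
have -> : \sum_(k <- F) block_weight k =
          \sum_(c <- map code F) \prod_r y r (c r).
  rewrite big_map; apply: eq_big_seq => k kF.
  rewrite (prod_undupE (hF _ kF) (fun r => hn k r kF)).
  apply: eq_bigr => r _; rewrite /y codeE.
  by rewrite -[X in (_ < X)%N](card_ord T) -(size_codom k) index_mem.
apply: le_trans (ler_sum_uniq _ _) _.
- by rewrite map_inj_in_uniq.
- move=> c; apply: prodr_ge0 => r _.
  by rewrite /y; case: ifP => // _; apply: weight_ge0.
(* In each factor the [T] positions contribute [T * 1/(T (r+1)^2)] and the absent value contributes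
   1. *)
rewrite -bigA_distr_bigA; apply: ler_prod => r _; apply/andP; split.
  by apply: sumr_ge0 => i _; rewrite /y; case: ifP => // _; apply: weight_ge0.
rewrite big_ord_recr/= {2}/y/= ltnn addrC lerD2l.
under eq_bigr => i _ do rewrite /y/= ltn_ord.
rewrite sumr_const card_ord /= -[X in X <= _]mulr_natl invfM mulrA divff ?mul1r//.
by rewrite pnatr_eq0 -lt0n.
Qed.

Lemma sum_block_weight_le4 pi T (F : seq {ffun 'I_T -> option nat}) :
  (0 < T)%N -> uniq F -> (forall k, k \in F -> feasible pi k) ->
  \sum_(k <- F) block_weight k <= 4.
Proof.
move=> T0 uF hF; have [n hn] := token_bound F.
exact: le_trans (sum_block_weight_le T0 uF hF hn) (prod_1Dinv_sqr_le4 n).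
Qed.

(** A block of length one has exactly one type, so the sum runs over single ranks [r] with weight
    [1/r^2] and not over sets of ranks. *)
Lemma sum_block_weight1_le2 pi (F : seq {ffun 'I_1 -> option nat}) :
  uniq F -> (forall k, k \in F -> feasible pi k) ->
  \sum_(k <- F) block_weight k <= 2.
Proof.
move=> uF hF; have [n hn] := token_bound F.
have codomE1 (k : {ffun 'I_1 -> option nat}) : codom k = [:: k ord0].
  by rewrite codomE enum_ordSl enum_ord0.
pose code (k : {ffun 'I_1 -> option nat}) : 'I_n.+1 :=
  inord (odflt 0%N (k ord0)).-1.
have someF k : k \in F -> exists2 r : 'I_n, k ord0 = Some r.+1 & code k = r :> nat.
  move=> kF; have := (hF _ kF).2; have := feasible_gt0 (hF _ kF).
  have := hn _ _ kF; rewrite /code codomE1; case: (k ord0) => [r|]; last first.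
    by rewrite !inE.
  move=> /(_ r); rewrite !inE eqxx => /(_ isT) rn /(_ r).
  rewrite !inE eqxx => /(_ isT) r0 _.
  have rn' : (r.-1 < n)%N by lia.
  by exists (Ordinal rn'); rewrite /= ?prednK// inordK//; lia.
have code_inj : {in F &, injective code}.
  move=> k k' kF k'F e; have [r kr er] := someF _ kF; have [r' kr' er'] := someF _ k'F.
  apply/ffunP => i; rewrite (ord1 i) kr kr'; congr (Some _.+1).
  by rewrite -er -er' e.
have -> : \sum_(k <- F) block_weight k =
          \sum_(c <- map code F) (c.+1%:R ^+ 2)^-1.
  rewrite big_map; apply: eq_big_seq => k /someF[r kr ->].
  by rewrite /block_weight codomE1 /= big_seq1 kr /= mul1r.
apply: le_trans (ler_sum_uniq _ _) (sum_inv_sqr_le2 n.+1).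
  by rewrite map_inj_in_uniq.
by move=> c; rewrite invr_ge0 exprn_ge0.
Qed.

End CodeWeights.

(** * Discrete random variables *)

Section DiscreteVariables.
Set Implicit Arguments. Unset Strict Implicit. Unset Printing Implicit Defensive.
Context {d : measure_display} {Omega : measurableType d} {R : realType}.
Variable P : probability Omega R.

(** Measurability for maps into discrete types: for countable [C], the preimage of every set is then
    measurable. *)
Definition measurable_fibers (C : Type) (X : Omega -> C) : Prop :=
  forall c, measurable [set w | X w = c].

Lemma measurable_fibers_preimage (C : countType) (X : Omega -> C) (E : set C) :
  measurable_fibers X -> measurable [set w | E (X w)].
Proof.
move=> mX.
have -> : [set w | E (X w)] =
    \bigcup_c (if pselect (E c) then [set w | X w = c] else set0).
  apply/seteqP; split => [w /= Ew|w [c _]].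
    by exists (X w) => //; case: pselect.
  by case: pselect => //= Ec ->.
apply: countable_bigcupT_measurable; first exact: countableP.
by move=> c; case: (pselect (E c)) => Ec; [exact: mX|exact: measurable0].
Qed.

Lemma measurable_fibers_map (I C : eqType) (Y : I -> Omega -> C) (s : seq I) :
  (forall i, i \in s -> measurable_fibers (Y i)) ->
  measurable_fibers (fun w => [seq Y i w | i <- s]).
Proof.
elim: s => [|i s ih] h [|c l] /=.
- by rewrite (_ : [set _ | _] = setT)//; apply/seteqP; split.
- by rewrite (_ : [set _ | _] = set0)//; apply/seteqP; split.
- by rewrite (_ : [set _ | _] = set0)//; apply/seteqP; split.
rewrite (_ : [set _ | _] =
  [set w | Y i w = c] `&` [set w | [seq Y i w | i <- s] = l]).
  apply: measurableI; first by apply: h; rewrite inE eqxx.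
  by apply: ih => j js; apply: h; rewrite inE js orbT.
by apply/seteqP; split => [w /= [-> ->]|w /= [-> ->]].
Qed.

Lemma measurable_fun_fibers (C : countType) (X : Omega -> C) (f : C -> \bar R) :
  measurable_fibers X -> measurable_fun setT (f \o X).
Proof.
move=> mX _ B _; rewrite setTI.
exact: (@measurable_fibers_preimage _ X (f @^-1` B)).
Qed.

Lemma integral_discrete (C : countType) (X : Omega -> C) (f : C -> \bar R) :
  measurable_fibers X -> (forall c, 0 <= f c)%E ->
  (\int[P]_w f (X w) = \esum_(c in [set: C]) (P [set w | X w = c] * f c))%E.
Proof.
move=> mX f0.
(* The codes [pickle] index the fibers by natural numbers, partitioning the space; a number that
   codes no value gives an empty piece. *)
pose F n := [set w | pickle (X w) = n].
have mF n : measurable (F n).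
  exact: (@measurable_fibers_preimage _ X (fun x => pickle x = n)).
have FT : \bigcup_n F n = setT.
  by apply/seteqP; split => // w _; exists (pickle (X w)).
have tF : trivIset setT F by move=> m n _ _ [w [<- <-]].
rewrite -{1}FT ge0_integral_bigcup//; last 1 first.
  by apply: measurable_funTS; exact: measurable_fun_fibers.
rewrite nneseries_esumT; last by move=> n; apply: integral_ge0 => w _.
rewrite (_ : \esum_(i in setT) _ =
  \esum_(i in pickle @` [set: C]) (\int[P]_(x in F i) f (X x))%E); last first.
  rewrite [RHS]esum_mkcond; apply: eq_esum => n _.
  case: ifPn => // /negP nin.
  rewrite (_ : F n = set0) ?integral_set0//.
  apply/seteqP; split => // w Fw; apply: nin; rewrite inE.
  by exists (X w).
rewrite esum_image; last by move=> c c' _ _; exact: (pcan_inj (@pickleK C)).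
apply: eq_esum => c _.
have -> : F (pickle c) = [set w | X w = c].
  by apply/seteqP; split => w /=; [exact: (pcan_inj (@pickleK C))|move=> <-].
rewrite muleC -(integral_cst P (mX c)).
by apply: eq_integral => w; rewrite inE => ->.
Qed.

Lemma integral_same_law (C : countType) (X Y : Omega -> C) (f : C -> \bar R) :
  measurable_fibers X -> measurable_fibers Y ->
  (forall c, P [set w | X w = c] = P [set w | Y w = c]) ->
  (forall c, 0 <= f c)%E -> (\int[P]_w f (X w) = \int[P]_w f (Y w))%E.
Proof.
move=> mX mY XY f0; rewrite !integral_discrete//.
by apply: eq_esum => c _; rewrite XY.
Qed.

Lemma prob_same_law (C : countType) (X Y : Omega -> C) (E : set C) :
  measurable_fibers X -> measurable_fibers Y ->
  (forall c, P [set w | X w = c] = P [set w | Y w = c]) ->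
  P [set w | E (X w)] = P [set w | E (Y w)].
Proof.
move=> mX mY XY.
have h (Z : Omega -> C) : measurable_fibers Z ->
    P [set w | E (Z w)] = (\int[P]_w (\1_E (Z w))%:E)%E.
  move=> mZ; have mE := measurable_fibers_preimage E mZ.
  by rewrite -[X in P X]setIT -integral_indic.
by rewrite !h//; apply: (@integral_same_law _ _ _ (fun c => (\1_E c)%:E)) .
Qed.

Lemma prob_eq_ae (A A' B : set Omega) : measurable A -> measurable A' ->
  measurable B -> P (~` B) = 0%E -> A `&` B = A' `&` B -> P A = P A'.
Proof.
move=> mA mA' mB B0 AB.
have h (D : set Omega) : measurable D -> P D = P (D `&` B).
  move=> mD; rewrite (measureDI P mD mB).
  rewrite [X in (X + _)%E](_ : _ = 0%E) ?add0e//; apply/eqP; rewrite eq_le measure_ge0.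
  rewrite andbT -B0 le_measure ?inE//.
  - exact: measurableD.
  - exact: measurableC.
by rewrite (h _ mA) AB -(h _ mA').
Qed.

End DiscreteVariables.

(** * Stationarity *)

Section Prefixes.
Local Open Scope nat_scope.
Set Implicit Arguments. Unset Strict Implicit. Unset Printing Implicit Defensive.
Variable pi : nat -> nat.
Implicit Types (phi psi sigma : nat -> nat) (r n t : nat).

(* Entry [i] of the list is the clock of rank [i.+1]. *)
Definition extend (s : seq nat) : nat -> nat := fun r => nth 0 s r.-1.

Lemma extend_map phi n r : 0 < r <= n -> extend (map phi (iota 1 n)) r = phi r.
Proof.
move=> /andP[r0 rn]; rewrite /extend (nth_map 0) ?size_iota; last by lia.
by rewrite nth_iota; [rewrite add1n prednK|lia].
Qed.

Lemma map_iota_eqP phi psi n :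
  (forall r, 0 < r <= n -> phi r = psi r) <->
  map phi (iota 1 n) = map psi (iota 1 n).
Proof.
split=> [h|/eq_in_map h r rn]; last by apply: h; rewrite mem_iota; lia.
by apply/eq_in_map => r; rewrite mem_iota => rn; apply: h; lia.
Qed.

Lemma map_extend s n : size s = n -> map (extend s) (iota 1 n) = s.
Proof.
move=> sn; apply: (@eq_from_nth _ 0); first by rewrite size_map size_iota.
move=> i; rewrite size_map size_iota => ni.
by rewrite (nth_map 0) ?size_iota// nth_iota.
Qed.

Lemma step_extend phi r : 0 < r ->
  step pi phi r = step pi (extend (map phi (iota 1 r))) r.
Proof. by move=> r0; apply: eq_step => // s rs; rewrite extend_map. Qed.

Lemma eq_unstep phi psi r : 0 < r ->
  (forall s, 0 < s <= r -> phi s = psi s) -> unstep pi phi r = unstep pi psi r.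
Proof.
move=> r0 h; rewrite /unstep (h r) ?r0 ?leqnn //.
congr (if _ then _ else _); apply: eq_in_all => s; rewrite mem_iota => hs.
by rewrite h//; lia.
Qed.

Lemma in_box_unstep psi : in_box pi psi -> in_box pi (unstep pi psi).
Proof.
move=> b r r0; move: (b r r0); rewrite /unstep.
by case: ifP => // _; case: (psi r =P pi r) => [_|]; lia.
Qed.

Lemma in_box_clocks sigma n : in_box pi sigma -> in_box pi (clocks pi sigma n).
Proof. by move=> b; elim: n => // n ih; apply: in_box_step. Qed.

(** Whether the next token is [r] depends on the first [r] clocks only, so measurability and laws of
    tokens reduce to finite lists. Restarted from these clocks, it is token number 1. *)
Lemma mp_token_prefix sigma t r : mp_token pi sigma t = Some r <->
  mp_token pi (extend (map (clocks pi sigma t.-1) (iota 1 r))) 1 = Some r.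
Proof.
split=> /eqP/mp_token_SomeP[r0 e h]; apply/eqP/mp_token_SomeP; split=> //.
- by rewrite /= extend_map ?r0 ?leqnn.
- by move=> s hs; rewrite /= extend_map ?h//; lia.
- by move: e; rewrite /= extend_map ?r0 ?leqnn.
- by move=> s hs; have := h _ hs; rewrite /= extend_map//; lia.
Qed.

End Prefixes.

(** * Invariance of the uniform law of the clocks *)

Section Stationarity.
Set Implicit Arguments. Unset Strict Implicit. Unset Printing Implicit Defensive.
Context {d : measure_display} {Omega : measurableType d} {R : realType}.
Variables (P : probability Omega R) (pi : nat -> nat) (Sigma : nat -> Omega -> nat).
Hypotheses (hpi : forall r, (0 < r)%N -> (0 < pi r)%N)
  (hmeas : measurable_seeds Sigma) (hunif : uniform_seeds P pi Sigma)
  (hind : independent_seeds P Sigma).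

Let clock n r w := clocks pi (Sigma^~ w) n r.
Let token t w := mpK pi Sigma t w.

Lemma measurable_clock n r : (0 < r)%N -> measurable_fibers (clock n r).
Proof.
elim: n r => [|n ih] r r0 i; first exact: hmeas.
pose f (s : seq nat) := step pi (extend s) r.
have fE w : clock n.+1 r w = f (map (clock n ^~ w) (iota 1 r)).
  exact: step_extend.
rewrite (_ : [set _ | _] = [set w | f (map (clock n ^~ w) (iota 1 r)) = i]); last first.
  by apply/seteqP; split=> w; rewrite /= -fE.
apply: (measurable_fibers_preimage (fun s => f s = i)).
by apply: measurable_fibers_map => s; rewrite mem_iota => hs; apply: ih; lia.
Qed.

Lemma measurable_prefix n m :
  measurable_fibers (fun w => map (clock n ^~ w) (iota 1 m)).
Proof.
apply: measurable_fibers_map => s; rewrite mem_iota => hs.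
by apply: measurable_clock; lia.
Qed.

Lemma measurable_token t : measurable_fibers (token t).
Proof.
have mS r : measurable [set w | token t w = Some r].
  pose E (s : seq nat) := mp_token pi (extend s) 1 = Some r.
  rewrite (_ : [set _ | _] = [set w | E (map (clock t.-1 ^~ w) (iota 1 r))]).
    by apply: measurable_fibers_preimage; apply: measurable_prefix.
  by apply/seteqP; split=> w; [move/mp_token_prefix|move=> h; apply/mp_token_prefix].
case=> [r|]; first exact: mS.
rewrite (_ : [set _ | _] = ~` \bigcup_r [set w | token t w = Some r]).
  by apply: measurableC; apply: bigcupT_measurable.
apply/seteqP; split=> w /=; first by move=> e [r _ /=]; rewrite e.
by case E: (token t w) => [r|] // h; case: h; exists r.
Qed.

(** The [pi r] values in range already carry mass [pi r * 1/(pi r) = 1]. *)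
Lemma seed_outside r i : (0 < r)%N -> ~~ (1 <= i <= pi r)%N ->
  P [set w | Sigma r w = i] = 0%E.
Proof.
move=> r0 hi.
pose A := [set w | (1 <= Sigma r w <= pi r)%N].
have mA : measurable A.
  exact: (measurable_fibers_preimage (fun j => (1 <= j <= pi r)%N)).
have PA : P A = 1%E.
  have -> : A = \bigcup_(j in `I_(pi r)) [set w | Sigma r w = j.+1].
    apply/seteqP; split => [w|w [j /=]]; rewrite /A /=.
      by move=> h; exists (Sigma r w).-1 => /=; lia.
    by move=> jr ->.
  rewrite measure_fin_bigcup//=.
  - rewrite -fsbig_ord.
    rewrite (eq_bigr (fun=> ((pi r)%:R^-1)%:E)); last first.
      by move=> j _; rewrite hunif//=.
    rewrite sumEFin sumr_const card_ord -[X in X%:E]mulr_natl divff//.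
    by rewrite pnatr_eq0 -lt0n hpi.
  - by move=> j k _ _ [w [/= -> []]].
apply/eqP; rewrite eq_le measure_ge0 andbT.
have : (P (~` A) <= 0)%E by rewrite probability_setC// PA subee.
apply: le_trans; rewrite le_measure ?inE//.
- exact: measurableC.
by move=> w /= e; rewrite /A /= e; apply/negP.
Qed.

Lemma seeds_in_box :
  measurable [set w | in_box pi (Sigma^~ w)] /\
  P (~` [set w | in_box pi (Sigma^~ w)]) = 0%E.
Proof.
pose N r := [set w | (0 < r)%N /\ ~~ (1 <= Sigma r w <= pi r)%N].
have mN r : measurable (N r).
  exact: (measurable_fibers_preimage (fun j => (0 < r)%N /\ ~~ (1 <= j <= pi r)%N)).
have e : ~` [set w | in_box pi (Sigma^~ w)] = \bigcup_r N r.
  apply/seteqP; split => w /=.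
    move=> nb; apply: contrapT => nN; apply: nb => r r0.
    apply: contrapT => /negP h; apply: nN; exists r => //.
  by move=> [r _ [r0 /negP h]] b; apply: h; apply: b.
have mB : measurable (~` [set w | in_box pi (Sigma^~ w)]).
  by rewrite e; exact: bigcupT_measurable.
split; first by rewrite -(setCK [set w | _]); exact: measurableC.
rewrite e; apply/negligibleP; first exact: bigcupT_measurable.
apply: negligible_bigcup => r.
have [r0|r0] := posnP r.
  apply: (@negligibleS _ _ _ P set0); last exact: negligible_set0.
  by move=> w [] /=; rewrite r0.
apply: (@negligibleS _ _ _ P (\bigcup_i (if (1 <= i <= pi r)%N then set0
   else [set w | Sigma r w = i]))).
  by move=> w [_ /negbTE h]; exists (Sigma r w) => //; rewrite h.
apply: negligible_bigcup => i; case: ifPn => [_|hi]; first exact: negligible_set0.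
by apply/negligibleP; [exact: hmeas|exact: seed_outside].
Qed.

(** Mass function of the uniform law on the product of the sets [{1..pi r}], [1 <= r <= m]. *)
Let boxp m (v : nat -> nat) : R :=
  \prod_(r <- iota 1 m) (if (1 <= v r <= pi r)%N then (pi r)%:R^-1 else 0).

(** On clocks within their periods [step] is a bijection with inverse [unstep], and it acts on the
    first [m] ranks by themselves; hence it preserves the uniform law of the seeds. *)
Lemma prob_prefix n m v :
  P [set w | map (clock n ^~ w) (iota 1 m) = map v (iota 1 m)] = (boxp m v)%:E.
Proof.
have [mB B0] := seeds_in_box.
elim: n v => [|n ih] v.
  rewrite (_ : [set _ | _] = [set w | forall r, r \in iota 1 m -> Sigma r w = v r]).
    rewrite hind ?iota_uniq//; last by apply/allP => r; rewrite mem_iota; lia.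
    rewrite /boxp -prodEFin; apply: eq_big_seq => r; rewrite mem_iota => hr.
    case: ifPn => h; first by rewrite hunif//; lia.
    by rewrite seed_outside//; lia.
  by apply/seteqP; split => w /=; [move/eq_in_map|move=> h; apply/eq_in_map].
have [vbox|/existsNP[r /not_implyP[hr vr]]] :=
    pselect (forall r, (0 < r <= m)%N -> (0 < v r <= pi r)%N); last first.
  rewrite (_ : boxp m v = 0); last first.
    apply/eqP; rewrite prodf_seq_eq0; apply/hasP; exists r; first by rewrite mem_iota; lia.
    by rewrite /=; case: ifP => // /vr.
  rewrite (_ : 0%:E = P set0) ; last by rewrite measure0.
  apply: (prob_eq_ae _ _ mB B0) => //.
    exact: measurable_prefix.
  rewrite set0I; apply/seteqP; split => // w [/= /map_iota_eqP /(_ _ hr) e b].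
  by apply: vr; rewrite -e; case/andP: hr => r0 _; exact: (in_box_clocks n.+1 b r0).
(* Only the first [m] values of [v] matter; the others are completed by the periods so that [unstep]
   applies to a point within the periods. *)
pose v' r := if (r <= m)%N then v r else pi r.
have v'box : in_box pi v'.
  move=> r r0; rewrite /v'; case: ifP => rm; first by apply: vbox; rewrite r0.
  by rewrite leqnn andbT hpi.
rewrite (_ : boxp m v = boxp m (unstep pi v')); last first.
  apply: eq_big_seq => r; rewrite mem_iota => hr.
  by rewrite vbox; [rewrite (in_box_unstep v'box)//; lia|lia].
(* Up to the null event of seeds out of range, the new clocks equal [v] on the first [m] ranks
   exactly when the old ones equal [unstep pi v'] there. *)
rewrite -ih; apply: (prob_eq_ae _ _ mB B0).
- exact: measurable_prefix.
- exact: measurable_prefix.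
apply/seteqP; split => w [/= /map_iota_eqP e b]; split=> //; apply/map_iota_eqP => r hr.
  have r0 : (0 < r)%N by lia.
  rewrite /clock -(stepK (in_box_clocks n b) r0).
  apply: eq_unstep => // s hs.
  by rewrite /v' ifT; [apply: e; lia|lia].
have r0 : (0 < r)%N by lia.
have -> : v r = v' r by rewrite /v' ifT//; lia.
rewrite -(unstepK v'box r0) -[LHS]/(step pi (clocks pi (Sigma^~ w) n) r).
by apply: eq_step => // s hs; apply: e; lia.
Qed.

(** A finite token is read off from a clock prefix, whose law is the same at all times; infinity
    then takes the remaining mass. *)
Lemma token_stationary t c :
  P [set w | token t w = c] = P [set w | token 1 w = c].
Proof.
have hS r : P [set w | token t w = Some r] = P [set w | token 1 w = Some r].
  pose E (s : seq nat) := mp_token pi (extend s) 1 = Some r.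
  have h u : [set w | token u w = Some r] =
             [set w | E (map (clock u.-1 ^~ w) (iota 1 r))].
    by apply/seteqP; split=> w; [move/mp_token_prefix|move=> h; apply/mp_token_prefix].
  rewrite !h; apply: prob_same_law; [exact: measurable_prefix..|].
  move=> s; have [sr|sr] := eqVneq (size s) r.
    by rewrite -(map_extend sr) !prob_prefix.
  have e0 u : [set w | map (clock u ^~ w) (iota 1 r) = s] = set0.
    apply/seteqP; split => // w /= e; move/eqP: sr; apply.
    by rewrite -e size_map size_iota.
  by rewrite !e0.
case: c => [r|]; first exact: hS.
have h u : [set w | token u w = None] = ~` \bigcup_r [set w | token u w = Some r].
  apply/seteqP; split=> w /=; first by move=> e [r _ /=]; rewrite e.
  by case E: (token u w) => [r|] // h; case: h; exists r.
have mU u : measurable (\bigcup_r [set w | token u w = Some r]).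
  by apply: bigcupT_measurable => r; exact: measurable_token.
rewrite !h !probability_setC//; congr (1 - _)%E.
rewrite !measure_bigcup//.
- by apply: eq_eseriesr => r _; exact: hS.
- by move=> r _; exact: measurable_token.
- by move=> i j _ _ [w [/= -> []]].
- by move=> r _; exact: measurable_token.
- by move=> i j _ _ [w [/= -> []]].
Qed.

Lemma integral_token_stationary t u (f : option nat -> \bar R) :
  (forall c, 0 <= f c)%E ->
  (\int[P]_w f (mpK pi Sigma t w) = \int[P]_w f (mpK pi Sigma u w))%E.
Proof.
move=> f0; apply: integral_same_law => //; [exact: measurable_token..|].
by move=> c; rewrite (token_stationary t) -(token_stationary u).
Qed.

Lemma measurable_block T :
  measurable_fibers (fun w => block pi (Sigma^~ w) T).
Proof.
move=> k.
rewrite (_ : [set _ | _] =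
  [set w | [seq token t.+1 w | t <- iota 0 T] = codom k]).
  by apply: measurable_fibers_map => t _; apply: measurable_token.
apply/seteqP; split => w /= => [<-|]; first by rewrite codom_block.
rewrite -[LHS]/(tokens pi (Sigma^~ w) T) -codom_block !codomE => /eq_in_map e.
by apply/ffunP => i; apply: e; rewrite mem_enum.
Qed.

Lemma prob_token1 : P [set w | token 1 w = Some 1%N] = ((pi 1)%:R^-1)%:E.
Proof.
rewrite -(@hunif 1%N _ 1%N)//; last by rewrite hpi.
congr (P _); apply/seteqP; split => w /=.
  by move/eqP/mp_token_SomeP => -[].
move=> e; apply/eqP/mp_token_SomeP; split => // s; lia.
Qed.

End Stationarity.

(** * The entropy bound *)

Section Gibbs.
Set Implicit Arguments. Unset Strict Implicit. Unset Printing Implicit Defensive.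
Context {d : measure_display} {Omega : measurableType d} {R : realType}.
Variable P : probability Omega R.

Lemma integral_cst_prob (x : \bar R) : (\int[P]__ x = x)%E.
Proof. by rewrite -[RHS]mule1 -(probability_setT P) -integral_cst. Qed.

(** This is [ln x <= x - 1] at [x = expR (- g) / p], multiplied by [p]. *)
Lemma gibbs_term (p g : R) : 0 < p -> - (p * ln p) + p <= p * g + expR (- g).
Proof.
move=> p0.
have h : ln (expR (- g) / p) <= expR (- g) / p - 1.
  rewrite -{1}(subrKC 1 (expR (- g) / p)); apply: le_ln1Dx.
  by rewrite ltrBrDl subrr divr_gt0// expR_gt0.
move: h; rewrite ln_div ?posrE ?expR_gt0// expRK => h.
have := ler_wpM2l (ltW p0) h.
by rewrite !mulrBr mulrCA divff ?gt_eqF// mulr1 mulrN; lra.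
Qed.

Lemma gibbs (C : countType) (X : Omega -> C) (p g : C -> R) :
  measurable_fibers X -> (forall c, P [set w | X w = c] = (p c)%:E) ->
  (forall c, 0 <= g c) ->
  (forall F : seq C, uniq F -> (forall c, c \in F -> 0 < p c) ->
     \sum_(c <- F) expR (- g c) <= 1) ->
  (\esum_(c in [set: C]) (- (p c * ln (p c)))%:E <= \int[P]_w (g (X w))%:E)%E.
Proof.
move=> mX pE g0 kraft.
have p0 c : 0 <= p c by rewrite -lee_fin -pE.
have p1 c : p c <= 1 by rewrite -lee_fin -pE probability_le1.
(* The bound on the weights is assumed on the support only, so the comparison mass vanishes
   elsewhere. *)
pose Q c := if 0 < p c then expR (- g c) else 0.
have Q0 c : 0 <= Q c by rewrite /Q; case: ifP => // _; exact: expR_ge0.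
have Q1 : (\esum_(c in [set: C]) (Q c)%:E <= 1)%E.
  apply: ge_ereal_sup => _ [/= F [finF _] <-].
  rewrite fsbig_finite//= sumEFin lee_fin /Q -big_mkcond -big_filter.
  apply: kraft; first by rewrite filter_uniq ?finmap.fset_uniq.
  by move=> c; rewrite mem_filter => /andP[].
have psum : \esum_(c in [set: C]) (p c)%:E = 1%E.
  rewrite -[RHS](integral_cst_prob).
  rewrite (@integral_discrete _ _ _ P _ X (fun=> 1%E))//.
  by apply: eq_esum => c _; rewrite mule1 pE.
have -> : (\int[P]_w (g (X w))%:E = \esum_(c in [set: C]) (p c * g c)%:E)%E.
  rewrite (integral_discrete P mX (f := fun c => (g c)%:E))//.
  by apply: eq_esum => c _; rewrite pE.
(* Adding the total mass 1 on both sides keeps all terms nonnegative and allows a termwise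
   comparison. *)
rewrite -(@leeD2rE _ 1%E)// -{1}psum.
apply: le_trans (leeD2l _ Q1).
rewrite -!esumD; last 4 first.
- by move=> c _; rewrite lee_fin mulr_ge0.
- by move=> c _; rewrite lee_fin.
- by move=> c _; rewrite lee_fin -mulrN mulr_ge0// oppr_ge0 ln_le0.
- by move=> c _; rewrite lee_fin.
apply: le_esum => c _; rewrite -!EFinD lee_fin /Q.
case: ifPn => [/gibbs_term//|]; rewrite -leNgt => pc.
have -> : p c = 0 by apply/eqP; rewrite eq_le pc p0.
by rewrite !mul0r oppr0.
Qed.

End Gibbs.

(** * Entropy of a block and the cost of its types *)

Section EntropyBound.
Set Implicit Arguments. Unset Strict Implicit. Unset Printing Implicit Defensive.
Context {d : measure_display} {Omega : measurableType d} {R : realType}.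
Variables (P : probability Omega R) (pi : nat -> nat) (Sigma : nat -> Omega -> nat).
Hypotheses (hpi : forall r, (0 < r)%N -> (0 < pi r)%N)
  (hmeas : measurable_seeds Sigma) (hunif : uniform_seeds P pi Sigma)
  (hind : independent_seeds P Sigma).
Variables (T : nat) (q : R).
Hypotheses (hT : (0 < T)%N) (hq : 0 < q).

Let X w := block pi (Sigma^~ w) T.
Let mX : measurable_fibers X := measurable_block pi hmeas (T := T).

Definition card_block (k : {ffun 'I_T -> option nat}) : nat :=
  size (undup (codom k)).

Lemma card_typesE w : card_types (mpK pi Sigma) T w = card_block (X w).
Proof.
rewrite /card_block codom_block /card_types; congr (size (undup _)).
by rewrite (iotaDl 1 0) -map_comp.
Qed.

Lemma card_block_gt0 k : (0 < card_block k)%N.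
Proof.
rewrite lt0n size_eq0 -size_eq0; apply/eqP => /size0nil e.
have : k (Ordinal hT) \in undup (codom k) by rewrite mem_undup codom_f.
by rewrite e.
Qed.

Lemma card_block_le k : (card_block k <= T)%N.
Proof.
by apply: leq_trans (size_undup _) _; rewrite size_codom card_ord.
Qed.

Lemma mean_card_fin : exists2 mu : R, 1 <= mu &
  (\int[P]_w ((card_types (mpK pi Sigma) T w)%:R : R)%:E)%E = mu%:E.
Proof.
set I := integral _ _ _.
have mc : measurable_fun setT ((fun k => (card_block k)%:R%:E : \bar R) \o X).
  exact: measurable_fun_fibers.
have IE : I = (\int[P]_w (card_block (X w))%:R%:E)%E.
  by apply: eq_integral => w _; rewrite card_typesE.
have I1 : (1 <= I)%E.
  rewrite IE -[leLHS](integral_cst_prob P).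
  apply: ge0_le_integral => //.
  by move=> w _; rewrite lee_fin ler1n card_block_gt0.
have IT : (I <= T%:R%:E)%E.
  rewrite IE -[leRHS](integral_cst_prob P).
  apply: ge0_le_integral => //.
  by move=> w _; rewrite lee_fin ler_nat card_block_le.
have If : I \is a fin_num 
  by rewrite ge0_fin_numE ?(le_lt_trans IT (ltry _))// (le_trans _ I1).
by exists (fine I); [rewrite -lee_fin fineK|rewrite fineK].
Qed.

Let root := @root_token R q.

Lemma root_ge0 o : (0 <= root o)%E.
Proof. by case: o => [r|] //=; rewrite lee_fin powR_ge0. Qed.

Lemma root_ge1 t w : (1 <= root (mpK pi Sigma t w))%E.
Proof.
rewrite /mpK; case E: (mp_token pi _ t) => [r|] /=; last exact: leey.
have r0 : (0 < r)%N by case/eqP/mp_token_SomeP: E.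
have e1 : 1 `^ q^-1 = 1 :> R by rewrite powR1.
by rewrite lee_fin -{1}e1 ge0_ler_powR ?nnegrE ?ler1n// invr_ge0 ltW.
Qed.

Lemma measurable_root t :
  measurable_fun setT (root \o (fun w => mpK pi Sigma t w)).
Proof. exact: measurable_fun_fibers (measurable_token pi hmeas t). Qed.

Lemma mean_root_ge1 t : (1 <= \int[P]_w root (mpK pi Sigma t w))%E.
Proof.
rewrite -[leLHS](integral_cst_prob P).
apply: ge0_le_integral => //.
- exact: measurable_root.
- by move=> w _; exact: root_ge1.
Qed.

Variables (t : nat) (a : R).
Hypothesis ha : (\int[P]_w root (mpK pi Sigma t w) = a%:E)%E.

Let a1 : 1 <= a. Proof. by rewrite -lee_fin -ha mean_root_ge1. Qed.

(** Infinity has infinite root, so a positive probability of it at time [u] would make the mean at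
    [u], equal to that at [t], infinite. *)
Lemma token_finite_ae u : P [set w | mpK pi Sigma u w = None] = 0%E.
Proof.
apply/eqP; rewrite eq_le measure_ge0 andbT leNgt; apply/negP => pos.
have := ha; rewrite (integral_token_stationary hpi hmeas hunif hind t u root_ge0).
rewrite (integral_discrete P (measurable_token pi hmeas u) root_ge0) => e.
suff : (+oo <= a%:E)%E by [].
rewrite -e; apply: esum_ge; exists [set None] => //.
by rewrite fsbig_set1 /= gt0_muley.
Qed.

Let p := @block_prob _ _ _ P (mpK pi Sigma) T.

Lemma block_probE k : P [set w | X w = k] = (p k)%:E.
Proof.
have e : [set w | X w = k] = [set w | forall i : 'I_T, mpK pi Sigma i.+1 w = k i].
  apply/seteqP; split => w /=; first by move=> <- i; rewrite ffunE.
  by move=> h; apply/ffunP => i; rewrite ffunE; exact: h.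
by rewrite /p /block_prob -e fineK// fin_num_measure//; exact: mX.
Qed.

Lemma feasible_support k : 0 < p k -> feasible pi k.
Proof.
move=> pk; split.
  apply: contrapT => nk; move: pk; rewrite -lte_fin -block_probE.
  rewrite (_ : [set _ | _] = set0) ?measure0 ?ltxx//.
  by apply/seteqP; split => // w e; apply: nk; exists (Sigma^~ w).
apply/negP => /codomP[i e]; move: pk; rewrite -lte_fin -block_probE ltNge => /negP; apply.
rewrite -[leRHS](token_finite_ae i.+1) le_measure ?inE//.
- exact: (measurable_token pi hmeas).
by move=> w /= Xw; rewrite e -Xw ffunE.
Qed.

(** Minus the logarithm of [weight] at a positive rank. Infinity is read as rank 0, and the
    convention [ln 0 = 0] leaves it the finite cost [ln T]. *)
Let cost (o : option nat) : R := ln T%:R + 2 * ln (odflt 0%N o)%:R.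

Let lnT0 : 0 <= ln T%:R :> R. Proof. by rewrite ln_ge0// ler1n. Qed.

Let cost_ge0 o : 0 <= cost o.
Proof.
rewrite addr_ge0// mulr_ge0//; case: o => [[|r]|] /=.
- by rewrite ln0.
- by rewrite ln_ge0// ler1n.
- by rewrite ln0.
Qed.

Let cost_weight r : (0 < r)%N -> expR (- cost (Some r)) = weight R T (Some r).
Proof.
move=> r0; have rp : 0 < r%:R :> R by rewrite ltr0n.
have Tp : 0 < T%:R :> R by rewrite ltr0n.
by rewrite /cost /= mulr_natl -lnXn// expRN expRD !lnK ?posrE ?exprn_gt0.
Qed.

(** Tangent point of the logarithm; the slope [2 q / B] times the mean [T a] of the sum of the roots
    is then exactly [2 q]. *)
Let B : R := T%:R * a.
Let B_ge1 : 1 <= B.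
Proof. by rewrite -[leLHS]mulr1 ler_pM// ler1n. Qed.

Let B_gt0 : 0 < B. Proof. exact: lt_le_trans B_ge1. Qed.
Let slope_ge0 : 0 <= 2 * q / B.
Proof. by rewrite divr_ge0 ?(ltW B_gt0)// mulr_ge0// ltW. Qed.

(* Tangent line of [ln] at [B], applied to [r = (r `^ q^-1) `^ q]. *)
Let cost_tangent o : o != Some 0%N ->
  ((cost o + 2 * q)%:E <=
   (ln T%:R + 2 * q * ln B)%:E + (2 * q / B)%:E * root o)%E.
Proof.
have B0 := B_gt0.
case: o => [r|] r0; last first.
  have c0 : (0 < (2 * q / B)%:E)%E by rewrite lte_fin divr_gt0// mulr_gt0.
  by rewrite /= gt0_muley// addey// leey.
have {}r0 : 0 < r%:R :> R by rewrite ltr0n lt0n; apply: contra r0 => /eqP ->.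
rewrite /root /= -EFinM -EFinD lee_fin /cost /=.
set y := r%:R `^ q^-1; have y0 : 0 < y by rewrite powR_gt0.
have -> : ln r%:R = q * ln y by rewrite /y ln_powR mulrA divff ?mul1r// gt_eqF.
have h : ln (y / B) <= y / B - 1.
  rewrite -{1}(subrKC 1 (y / B)); apply: le_ln1Dx.
  by rewrite ltrBrDl subrr divr_gt0.
move: h; rewrite ln_div ?posrE// => /(ler_wpM2l (ltW hq)) h.
have -> : 2 * q / B * y = 2 * (q * (y / B)) by ring.
by move: h; rewrite !mulrBr mulr1; lra.
Qed.

(** The term [ln Z] normalizes the weights: on feasible blocks [expR (- g Z k)] is the block weight
    over [Z]. *)
Let g (Z : R) (k : {ffun 'I_T -> option nat}) : R :=
  ln Z + \sum_(o <- undup (codom k)) cost o.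

Let expR_g Z k : 0 < Z -> feasible pi k -> expR (- g Z k) = Z^-1 * block_weight R k.
Proof.
move=> Z0 fk; rewrite /g opprD expRD expRN lnK ?posrE// -sumrN.
rewrite expR_sum /block_weight; congr (_ * _); apply: eq_big_seq => -[r|].
  by rewrite mem_undup => /(feasible_gt0 fk); exact: cost_weight.
by rewrite mem_undup; case: fk => _ /negbTE ->.
Qed.

Lemma sum_undup_le (I : eqType) (f : I -> \bar R) (s : seq I) :
  (forall i, 0 <= f i)%E ->
  (\sum_(i <- undup s) f i <= \sum_(i <- s) f i)%E.
Proof.
move=> f0; elim: s => [|i s ih] /=; first by rewrite !big_nil.
rewrite big_cons; case: ifP => _; last by rewrite big_cons leeD2l.
by apply: (le_trans ih); rewrite leeDr.
Qed.

(** Tangent lines summed over the types. The constants [2 q] stay on the left, so that both sides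
    can be integrated as nonnegative functions. *)
Let g_le Z w :
  ((g Z (X w) + 2 * q * (card_block (X w))%:R)%:E <=
   (ln Z + (card_block (X w))%:R * (ln T%:R + 2 * q * ln B))%:E +
     (2 * q / B)%:E * \sum_(i < T) root (X w i))%E.
Proof.
rewrite /g /card_block -addrA (EFinD (ln Z)) (EFinD (ln Z)) -addeA leeD2l//.
set s := undup _.
have -> : (\sum_(o <- s) cost o + 2 * q * (size s)%:R)%:E =
          (\sum_(o <- s) (cost o + 2 * q)%:E)%E.
  move: (cost) => c.
  by rewrite sumEFin big_split/= big_const_seq count_predT iter_addr_0 mulr_natr.
have -> : ((size s)%:R * (ln T%:R + 2 * q * ln B))%:E =
          (\sum_(o <- s) (ln T%:R + 2 * q * ln B)%:E)%E.
  by rewrite sumEFin big_const_seq count_predT iter_addr_0 mulr_natl.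
(* Distinct types give way to all positions, where stationarity will give each mean; only
   nonnegative terms are added. *)
have rs : (\sum_(o <- s) root o <= \sum_(i < T) root (X w i))%E.
  apply: (le_trans (sum_undup_le _ root_ge0)).
  by rewrite codomE big_map big_enum.
apply: le_trans (leeD2l _ (lee_wpmul2l _ rs)); last by rewrite lee_fin.
rewrite ge0_sume_distrr -?big_split/=; last by move=> o _; exact: root_ge0.
rewrite big_seq [leRHS]big_seq; apply: lee_sum => o.
rewrite mem_undup codom_block => /mapP[u _ ->].
by apply: cost_tangent; exact: mp_token_gt0.
Qed.

(** Gibbs' inequality bounds the entropy by the mean of [g], and [g_le] is integrated with all
    positions contributing the same mean root [a]. *)
Lemma block_entropy_le_of_weights (Z mu : R) : 1 <= Z -> 1 <= mu ->
  (\int[P]_w ((card_types (mpK pi Sigma) T w)%:R : R)%:E)%E = mu%:E ->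
  (forall F : seq {ffun 'I_T -> option nat}, uniq F ->
     (forall k, k \in F -> feasible pi k) -> \sum_(k <- F) block_weight R k <= Z) ->
  (block_entropy P (mpK pi Sigma) T <=
   (ln Z + mu * ln T%:R + 2 * q * mu * ln (T%:R * a))%:E)%E.
Proof.
move=> Z1 mu1 hmu kraft.
have Z0 : 0 < Z by apply: lt_le_trans Z1.
have q0 := ltW hq; have lnB0 : 0 <= ln B by rewrite ln_ge0.
have lnZ0 : 0 <= ln Z by rewrite ln_ge0.
have g0 k : 0 <= g Z k by rewrite addr_ge0// sumr_ge0.
have muE : (\int[P]_w (card_block (X w))%:R%:E = mu%:E)%E.
  by rewrite -hmu; apply: eq_integral => w _; rewrite card_typesE.
have G_ge : (block_entropy P (mpK pi Sigma) T <= \int[P]_w (g Z (X w))%:E)%E.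
  apply: gibbs => //; first exact: block_probE.
  move=> F uF hF; rewrite (eq_big_seq (fun k => Z^-1 * block_weight R k)).
    rewrite -mulr_sumr mulrC ler_pdivrMr// mul1r; apply: kraft => // k /hF.
    exact: feasible_support.
  by move=> k /hF /feasible_support; exact: expR_g.
have mf (f : {ffun 'I_T -> option nat} -> \bar R) : measurable_fun setT (f \o X).
  exact: measurable_fun_fibers.
have root_sum0 (k : {ffun 'I_T -> option nat}) : (0 <= \sum_(i < T) root (k i))%E.
  by apply: sume_ge0 => i _; exact: root_ge0.
have GE : (\int[P]_w (g Z (X w) + 2 * q * (card_block (X w))%:R)%:E =
           \int[P]_w (g Z (X w))%:E + (2 * q * mu)%:E)%E.
  under eq_integral do rewrite EFinD.
  rewrite ge0_integralD//; last 4 first.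
  - by move=> w _; rewrite lee_fin.
  - exact: (mf (fun k => (g Z k)%:E)).
  - by move=> w _; rewrite lee_fin !mulr_ge0.
  - exact: (mf (fun k => (2 * q * (card_block k)%:R)%:E)).
  congr (_ + _)%E; under eq_integral do rewrite EFinM.
  rewrite ge0_integralZl_EFin ?muE ?mulr_ge0//.
  exact: (mf (fun k => (card_block k)%:R%:E)).
have RE : (\int[P]_w ((ln Z + (card_block (X w))%:R * (ln T%:R + 2 * q * ln B))%:E +
     (2 * q / B)%:E * \sum_(i < T) root (X w i)) =
   (ln Z + mu * (ln T%:R + 2 * q * ln B) + 2 * q)%:E)%E.
  have l0 : 0 <= ln T%:R + 2 * q * ln B by rewrite addr_ge0// !mulr_ge0.
  rewrite ge0_integralD//; last 4 first.
  - by move=> w _; rewrite lee_fin addr_ge0// mulr_ge0.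
  - exact: (mf (fun k => (ln Z + (card_block k)%:R * (ln T%:R + 2 * q * ln B))%:E)).
  - by move=> w _; rewrite mule_ge0.
  - exact: (mf (fun k => (2 * q / B)%:E * \sum_(i < T) root (k i))%E).
  rewrite EFinD; congr (_ + _)%E.
    under eq_integral do rewrite EFinD.
    rewrite ge0_integralD//; last 2 first.
    - by move=> w _; rewrite lee_fin mulr_ge0.
    - exact: (mf (fun k => ((card_block k)%:R * (ln T%:R + 2 * q * ln B))%:E)).
    rewrite integral_cst_prob EFinD; congr (_ + _)%E.
    under eq_integral do rewrite mulrC EFinM.
    rewrite ge0_integralZl_EFin//; last exact: (mf (fun k => (card_block k)%:R%:E)).
    by rewrite muE -EFinM mulrC.
  rewrite ge0_integralZl_EFin//; last first.
    exact: (mf (fun k => \sum_(i < T) root (k i))%E).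
  rewrite ge0_integral_sum//; last 2 first.
  - by move=> i; exact: (mf (fun k => root (k i))).
  - by move=> i w _; exact: root_ge0.
  rewrite (eq_bigr (fun=> a%:E)); last first.
    move=> i _; rewrite -ha (integral_token_stationary hpi hmeas hunif hind t i.+1 root_ge0).
    by apply: eq_integral => w _; rewrite ffunE.
  rewrite sumEFin sumr_const card_ord -EFinM -[a *+ T]mulr_natl -/B divfK//.
  by rewrite gt_eqF.
have le1 : (\int[P]_w (g Z (X w))%:E + (2 * q * mu)%:E <=
           (ln Z + mu * (ln T%:R + 2 * q * ln B) + 2 * q)%:E)%E.
  rewrite -GE -RE; apply: ge0_le_integral => //.
  - by move=> w _; rewrite lee_fin addr_ge0// !mulr_ge0.
  - exact: (mf (fun k => (g Z k + 2 * q * (card_block k)%:R)%:E)).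
  - exact: (mf (fun k => ((ln Z + (card_block k)%:R * (ln T%:R + 2 * q * ln B))%:E +
      (2 * q / B)%:E * \sum_(i < T) root (k i))%E)).
apply: (le_trans G_ge); rewrite -(@leeD2rE _ (2 * q * mu)%:E)//.
apply: (le_trans le1); rewrite -EFinD lee_fin -/B.
(* The tangent lines gain [2 q] per type, [2 q mu] in the mean, against the single [2 q] from the
   slope; [mu >= 1] settles the comparison. *)
rewrite -subr_ge0.
have -> : ln Z + mu * ln T%:R + 2 * q * mu * ln B + 2 * q * mu -
  (ln Z + mu * (ln T%:R + 2 * q * ln B) + 2 * q) = 2 * q * (mu - 1) by ring.
by rewrite !mulr_ge0// subr_ge0.
Qed.

(* [K_1] is at least 2 with probability at least 1/2, and AM-GM. *)
Lemma ln2_le_mean_root : (1 < pi 1)%N -> ln 2 <= 2 * q * ln a.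
Proof.
move=> pi1; pose u : R := 2 `^ (q^-1 / 2); pose s : R := 2 `^ q^-1.
have u0 : 0 < u by rewrite powR_gt0.
have su : s = u * u.
  by rewrite /s /u -powRD; [congr (_ `^ _); field; rewrite gt_eqF|rewrite pnatr_eq0 implybT].
have q'0 : 0 <= q^-1 by rewrite invr_ge0 ltW.
have s1 : 1 <= s by rewrite -(powRr0 2) ler_powR// ler1n.
pose A := [set w | mpK pi Sigma 1 w = Some 1%N].
have mA : measurable A by exact: measurable_token.
have mroot := measurable_root 1.
have mind : measurable_fun setT (fun w => (\1_A w)%:E : \bar R).
  exact/measurable_EFinP.
(* Pointwise, the root is at least [s] off [A] and at least 1 on [A], so adding [s - 1] on [A] makes
   it at least [s] everywhere. *)
have as_ : (s%:E <= a%:E + (s - 1)%:E * P A)%E.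
  rewrite -[leLHS](integral_cst_prob P) -ha.
  rewrite (integral_token_stationary hpi hmeas hunif hind t 1 root_ge0).
  rewrite -[A]setIT -(integral_indic P measurableT mA).
  rewrite -ge0_integralZl_EFin ?subr_ge0//.
  rewrite -ge0_integralD//; last 3 first.
  - by move=> w _; exact: root_ge0.
  - by move=> w _; rewrite mule_ge0// lee_fin// subr_ge0.
  - exact: measurable_funeM.
  apply: ge0_le_integral => //.
  - by move=> w _; rewrite lee_fin (le_trans _ s1).
  - by apply: emeasurable_funD => //; exact: measurable_funeM.
  move=> w _; rewrite indicE; have [wA|/negP wA] := boolP (w \in A).
    rewrite mule1 -[leLHS]/(s%:E) -{1}(subrKC 1 s) EFinD leeD2r//.
    exact: root_ge1.
  rewrite mule0 adde0 /mpK; case E : (mp_token pi _ 1) => [r|] /=; last exact: leey.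
  have r0 : r != 0%N by move: (mp_token_gt0 pi (Sigma^~ w) 1); rewrite E.
  have r1 : r != 1%N by apply/eqP => r1; apply: wA; rewrite inE /A /= /mpK E r1.
  by rewrite lee_fin ge0_ler_powR ?nnegrE// ler_nat; case: r r0 r1 {E} => [|[|r]].
move: as_; rewrite prob_token1// -EFinM -EFinD lee_fin => as_.
have ua : u <= a.
  (* Since [P A <= 1/2], one gets [a >= (s + 1)/2 = (u^2 + 1)/2 >= u], and [2 q ln u = ln 2]. *)
  have pi2 : (pi 1)%:R^-1 <= 2^-1 :> R by rewrite lef_pV2 ?posrE ?ltr0n ?ler_nat// hpi.
  have : (s - 1) * (pi 1)%:R^-1 <= (s - 1) * 2^-1 by rewrite ler_wpM2l// subr_ge0.
  have : 0 <= (u - 1) * (u - 1) by rewrite -expr2 sqr_ge0.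
  by move: as_; rewrite su; lra.
have : ln u <= ln a by rewrite ler_ln ?posrE// (lt_le_trans _ a1).
rewrite ln_powR => /(ler_wpM2l (ltW (mulr_gt0 (ltr0n _ 2) hq))).
by rewrite (_ : 2 * q * (q^-1 / 2 * ln 2) = ln 2)//; field; rewrite gt_eqF.
Qed.

End EntropyBound.

(** * Assembly of the bound, with blocks of length one treated apart *)

Lemma block_entropy1_eq0 (R : realType) (d : measure_display)
    (Omega : measurableType d) (P : probability Omega R)
    (K : nat -> Omega -> option nat) (c : option nat) :
  measurable_fibers (K 1%N) -> P [set w | K 1%N w = c] = 1%E ->
  block_entropy P K 1 = 0%E.
Proof.
move=> mK Kc; apply: esum1 => k _.
have -> : block_prob P K k = fine (P [set w | K 1%N w = k ord0]).
  congr (fine (P _)); apply/seteqP; split => w /= h; first exact: h ord0.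
  by move=> i; rewrite (ord1 i).
have [->|kc] := eqVneq (k ord0) c; first by rewrite Kc /= ln1 mulr0 oppr0.
suff -> : P [set w | K 1%N w = k ord0] = 0%E by rewrite /= mul0r oppr0.
apply/eqP; rewrite eq_le measure_ge0 andbT.
have : (P (~` [set w | K 1%N w = c]) <= 0)%E by rewrite probability_setC// Kc subee.
apply: le_trans; rewrite le_measure ?inE//; first exact: measurableC.
by move=> w /= ->; apply/eqP.
Qed.

Theorem theorem7 (R : realType) (d : measure_display) (Omega : measurableType d)
    (P : probability Omega R) (pi : nat -> nat) (Sigma : nat -> Omega -> nat)
    (hpi : forall r, (0 < r)%N -> (0 < pi r)%N)
    (hmeas : measurable_seeds Sigma)
    (hunif : uniform_seeds P pi Sigma)
    (hind : independent_seeds P Sigma)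
    (T : nat) (hT : (1 <= T)%N) (t : nat) (ht : (1 <= t)%N)
    (q : R) (hq : 0 < q) :
  (block_entropy P (mpK pi Sigma) T <=
   ((expR (1:R))%:E * (\int[P]_w ((card_types (mpK pi Sigma) T w)%:R : R)%:E) + 2%:E) *
   (((q + 2) * ln (T%:R : R))%:E
     + q%:E * elog (\int[P]_w (root_token q (mpK pi Sigma t w)))))%E.
Proof.
have e2 : 2 <= expR 1 :> R by apply: le_trans (expR_ge1Dx 1); lra.
have [mu mu1 hmu] := mean_card_fin P pi hmeas hT.
rewrite hmu -EFinM -EFinD.
(* The bound is proved with 2 in place of [e] and then weakened by [2 <= e]. *)
have emu : 2 * mu + 2 <= expR 1 * mu + 2 by rewrite lerD2r ler_wpM2r// (le_trans _ mu1).
have emu0 : 0 < expR 1 * mu + 2 by apply: lt_le_trans emu; lra.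
have := mean_root_ge1 P pi hmeas hq t.
(* An infinite mean root makes the right side infinite, as [q] and the first factor are positive. *)
case ha : (\int[P]_w _)%E => [a| |] //; last first.
  move=> _; rewrite /= gt0_muley ?lte_fin// addey// gt0_muley ?lte_fin//.
  exact: leey.
rewrite lee_fin => a1.
have a0 : 0 < a by apply: lt_le_trans a1.
have l0 : 0 <= ln a by rewrite ln_ge0.
have ql0 : 0 <= q * ln a by rewrite mulr_ge0// ltW.
rewrite /= -[(q%:E * _)%E]EFinM -EFinD -EFinM.
have bound Z Z1 := block_entropy_le_of_weights hpi hmeas hunif hind hT hq ha (Z := Z) Z1 mu1 hmu.
have [T2|T1] := ltnP 1 T.
  have L2 : ln 2 <= ln T%:R :> R.
    by rewrite ler_ln ?posrE ?ler_nat// ltr0n.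
  have L0 : 0 <= ln T%:R :> R by rewrite ln_ge0// ler1n.
  apply: le_trans (bound 4 _ _) _; first by rewrite ler1n.
    by move=> F uF hF; exact: sum_block_weight_le4 hF.
  rewrite lee_fin lnM ?posrE ?ltr0n//.
  have -> : ln 4 = 2 * ln 2 :> R by rewrite mulr_natl -lnXn// -natrX.
  set L := ln T%:R in L2 L0 *; set l := ln a in l0 ql0 *.
  have S0 : 0 <= (q + 2) * L + q * l by rewrite addr_ge0// mulr_ge0// addr_ge0// ltW.
  apply: le_trans (ler_wpM2r S0 emu).
  have qL0 : 0 <= q * L by rewrite mulr_ge0// ltW.
  have muL : 0 <= mu * L by rewrite mulr_ge0// (le_trans _ mu1).
  rewrite -subr_ge0.
  (* Of the [4 L] in the product, [2 L] pays for [ln 4 = 2 ln 2], as [T >= 2]. *)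
  have -> : (2 * mu + 2) * ((q + 2) * L + q * l) -
      (2 * ln 2 + mu * L + 2 * q * mu * (L + l)) =
    3 * (mu * L) + 2 * (q * L) + 2 * (q * l) + 2 * L + 2 * (L - ln 2) by ring.
  by lra.
have {T1} T1 : T = 1%N by apply/eqP; rewrite eqn_leq T1 hT.
subst T; rewrite ln1 !mulr0 add0r.
(* For [T = 1] the right side is a multiple of [q ln a]. If [pi 1 = 1], the first token is almost
   surely 1 and the entropy vanishes. *)
have [pi1|pi1] := ltnP 1 (pi 1%N); last first.
  have {}pi1 : pi 1%N = 1%N by apply/eqP; rewrite eqn_leq pi1 hpi.
  rewrite (block_entropy1_eq0 (measurable_token pi hmeas 1%N) (c := Some 1%N)).
    by rewrite lee_fin mulr_ge0// ltW.
  by rewrite (prob_token1 hpi hunif) pi1 invr1.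
apply: le_trans (bound 2 _ _) _; first by rewrite ler1n.
  by move=> F uF hF; exact: sum_block_weight1_le2 uF hF.
rewrite lee_fin ln1 mulr0 addr0 mul1r.
(* The inequality [ln 2 <= 2 q ln a] turns the bound into [(2 mu + 2) q ln a]. *)
have := ln2_le_mean_root hpi hmeas hunif hind hq ha pi1.
have := ler_wpM2r ql0 emu.
by set l := ln a; lra.
Qed.
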